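(* (i) There exist a constant $\lambda_+>1$ and a neighbourhood $N\subset\mathbb H$ of the interval $[-\infty,0]\subset\partial\mathbb H$ such that $\chi(\alpha z)<\lambda_+\chi(z)$ and $\chi(\beta z)<\lambda_+\chi(z)$ for all $z\in N$. (ii) For every real $K>1$, there exist a constant $\lambda_-$ with $1<\lambda_-<\lambda_+$ and neighbourhoods $N_1\subset\mathbb H$ of the interval $[-K,-1]\subset\partial\mathbb H$ and $N_2\subset\mathbb H$ of the interval $[-1,-1/K]\subset\partial\mathbb H$ such that $\chi(\alpha z)>\lambda_-\chi(z)$ for all $z\in N_1$, and $\chi(\beta z)>\lambda_-\chi(z)$ for all $z\in N_2$.
   Context: $\mathbb H$ is the complex upper half-plane with boundary $\partial\mathbb H=\widehat{\mathbb R}=\mathbb R\cup\{\infty\}$; $\alpha(z)=z+1$ and $\beta(z)=z/(z+1)$. The potential function $\chi:\mathbb H\to\mathbb R^{>0}\cup\{\infty\}$ is $$\chi(z)=\tfrac12\log\left|\frac{z+i}{z-i}\right|.$$ The interval $[-\infty,0]$ is the closed arc of $\partial\mathbb H$ consisting of $\infty$ and the non-positive reals. A neighbourhood in $\mathbb H$ of a closed arc of $\partial\mathbb H$ means the intersection with $\mathbb H$ of an open neighbourhood of that arc in $\widehat{\mathbb C}$. *)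

(* Defs.v *)
From HB Require Import structures.
From mathcomp Require Import all_boot all_order all_algebra.
From mathcomp Require Import all_classical all_reals all_analysis.
From mathcomp Require Import complex.
Import Order.TTheory GRing.Theory Num.Theory.
Import numFieldNormedType.Exports.

Set Implicit Arguments.
Unset Strict Implicit.
Unset Printing Implicit Defensive.

Local Open Scope classical_set_scope.
Local Open Scope ring_scope.
Local Open Scope complex_scope.

(* The Riemann sphere; [Some z] is the finite point z and [None] is the point
   at infinity.  The [^o] selects the topology of R[i] given by its modulus. *)
Definition sphere (R : realType) := one_point_compactification (R[i]^o).

Definition upper_half_plane (R : realType) : set R[i] := [set z | 0 < complex.Im z].
Arguments upper_half_plane : clear implicits.

Definition alpha (R : realType) (z : R[i]) : R[i] := z + 1.

(* Only used on the upper half-plane, where z + 1 != 0. *)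
Definition beta (R : realType) (z : R[i]) : R[i] := z / (z + 1).

(* `|w| is an element of R[i] with zero imaginary part, whence the Re. *)
Definition chi (R : realType) (z : R[i]) : \bar R :=
  if z == 'i%C then +oo%E
  else (2^-1 * ln (complex.Re `|(z + 'i%C) / (z - 'i%C)|))%:E.

Definition real_arc (R : realType) (a b : R) : set (sphere R) :=
  [set Some (x%:C : R[i]^o) | x in `[a, b]].

Definition nonpositive_arc (R : realType) : set (sphere R) :=
  [set None] `|` [set Some (x%:C : R[i]^o) | x in `]-oo, 0]].
Arguments nonpositive_arc : clear implicits.

Definition half_plane_nbhd (R : realType) (A : set (sphere R)) (N : set R[i]) :=
  exists U : set (sphere R),
    [/\ open U, A `<=` U & N = upper_half_plane R `&` Some @^-1` U].

(* Main.v *)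
Require Import Defs.
From HB Require Import structures.
From mathcomp Require Import all_boot all_order all_algebra.
From mathcomp Require Import all_classical all_reals all_analysis.
From mathcomp Require Import complex.
From mathcomp Require Import ring lra.
Import Order.TTheory GRing.Theory Num.Theory.
Import numFieldNormedType.Exports.

Local Open Scope classical_set_scope.
Local Open Scope ring_scope.

Set Implicit Arguments.
Unset Strict Implicit.
Unset Printing Implicit Defensive.

(** With u(z) = 2 Im z / (1 + |z|^2), here called the height of z, one has
    |z + i|^2 = (1 + |z|^2) (1 + u(z)) and |z - i|^2 = (1 + |z|^2) (1 - u(z)),
    so that chi(z) = artanh(u(z)) / 2 ([chiE]).  The height takes values in
    ]0, 1] on the upper half-plane, vanishes on its boundary, and equals 1 only
    at i.  The two maps act on it by

      u(alpha z) / u(z) = (1 + |z|^2) / (1 + |z + 1|^2),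
      u(beta z) / u(z) = (1 + |z|^2) / (|z|^2 + |z + 1|^2).

    Both ratios are at most 3 everywhere.  Since artanh is asymptotic to the
    identity at 0, the potential itself grows by a factor less than
    lambda_+ = 4 as soon as u(z) is small; u(z) < 1/5 is enough
    ([artanh_triple_lt]), and this condition describes an open set of the sphere
    containing the whole boundary circle.

    For the lower bound, artanh is convex on [0, 1[ and vanishes at 0, hence
    k artanh u <= artanh (k u) for k >= 1 ([artanh_superlinear]): a growth of the
    height by a factor larger than k is inherited by the potential, without any
    smallness condition.  At a real point x the numerator of the first ratio
    exceeds its denominator by - 2 x - 1, which is at least 1 on [- K, - 1]; the
    numerator of the second one exceeds its denominator by - x (2 + x), which is
    at least 1 / K on [- 1, - 1 / K].  As the denominators are less than 1 + K^2
    and at most 1 there, both ratios exceed k = 1 + 1 / (1 + K^2) on the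
    respective arcs, and each set where the ratio exceeds k is open: it is one
    side of a circle. *)

(** * The height function *)

Definition normsq (R : realType) (z : R[i]) : R :=
  complex.Re z ^+ 2 + complex.Im z ^+ 2.

(** The invariant form of the distance to i: u = sech d, where d is the
    hyperbolic distance from z to i.  It is also the third coordinate of the
    stereographic image of z on the unit sphere, with poles at i and - i. *)
Definition height (R : realType) (z : R[i]) : R :=
  2 * complex.Im z / (1 + normsq z).

Lemma normsq_ge0 (R : realType) (z : R[i]) : 0 <= normsq z.
Proof. by rewrite addr_ge0// sqr_ge0. Qed.

Lemma normsq_gt0 (R : realType) (z : R[i]) : 0 < complex.Im z -> 0 < normsq z.
Proof. by move=> z0; rewrite ltr_wpDl ?sqr_ge0// exprn_gt0. Qed.

Lemma add1_normsq_gt0 (R : realType) (z : R[i]) : 0 < 1 + normsq z.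
Proof. by rewrite ltr_wpDr// normsq_ge0. Qed.

Lemma height_gt0 (R : realType) (z : R[i]) : 0 < complex.Im z -> 0 < height z.
Proof.
by move=> z0; rewrite divr_gt0 ?mulr_gt0// ltr_pwDl// normsq_ge0.
Qed.

(** 1 + |z|^2 - 2 Im z = |z - i|^2. *)
Lemma height_lt1 (R : realType) (z : R[i]) : z != 'i%C -> height z < 1.
Proof.
move=> zi; have b0 := normsq_ge0 z.
rewrite /height ltr_pdivrMr; last lra.
move: zi b0; case: z => x y; rewrite eq_complex /normsq/= => zi b0.
have /orP[x0|y1] : (x != 0) || (y - 1 != 0) by rewrite subr_eq0 -negb_and.
  have := sqr_ge0 (y - 1); have : 0 < x ^+ 2 by rewrite exprn_even_gt0.
  by nra.
have := sqr_ge0 x; have : 0 < (y - 1) ^+ 2 by rewrite exprn_even_gt0.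
by nra.
Qed.

Lemma height_i (R : realType) : height ('i%C : R[i]) = 1.
Proof. by rewrite /height /normsq/=; field. Qed.

(** * The action of the two maps on heights *)

Lemma Im_alpha (R : realType) (z : R[i]) :
  complex.Im (alpha z) = complex.Im z.
Proof. by case: z => x y; rewrite /alpha/= addr0. Qed.

Lemma normsq_alpha (R : realType) (z : R[i]) :
  normsq (alpha z) = normsq z + 2 * complex.Re z + 1.
Proof. by case: z => x y; rewrite /normsq /alpha/=; ring. Qed.

Lemma Im_beta (R : realType) (z : R[i]) :
  complex.Im (beta z) = complex.Im z / normsq (alpha z).
Proof.
case: z => x y.
rewrite /normsq /alpha /beta/=.
by rewrite !addr0; set D := (_ + _ ^+ 2)^-1; ring.
Qed.

Lemma normsq_beta (R : realType) (z : R[i]) : 0 < complex.Im z ->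
  normsq (beta z) = normsq z / normsq (alpha z).
Proof.
move=> z0; have := @normsq_gt0 _ (alpha z); rewrite Im_alpha => /(_ z0).
case: z z0 => x y /= y0.
rewrite /normsq /alpha /beta/= !addr0 => /lt0r_neq0 D0.
by field.
Qed.

Lemma normsq_pair_gt0 (R : realType) (z : R[i]) : 0 < complex.Im z ->
  0 < normsq z + normsq (alpha z).
Proof. by move=> z0; rewrite ltr_wpDr ?normsq_ge0 ?normsq_gt0. Qed.

Lemma height_alpha (R : realType) (z : R[i]) :
  height (alpha z) = 2 * complex.Im z / (1 + normsq (alpha z)).
Proof. by rewrite /height Im_alpha. Qed.

Lemma height_beta (R : realType) (z : R[i]) : 0 < complex.Im z ->
  height (beta z) = 2 * complex.Im z / (normsq z + normsq (alpha z)).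
Proof.
move=> z0; rewrite /height Im_beta normsq_beta//.
have a0 : 0 < normsq (alpha z) by rewrite normsq_gt0// Im_alpha.
have b0 := normsq_ge0 z.
by field; rewrite !lt0r_neq0//; lra.
Qed.

Lemma le_divl_scaled (R : realFieldType) (y p q k : R) : 0 < y -> 0 < p -> 0 < q ->
  (y / p <= k * (y / q)) = (q <= k * p).
Proof.
move=> y0 p0 q0; rewrite ler_pdivrMr// -mulrA mulrAC mulrA ler_pdivlMr//.
by rewrite mulrCA ler_pM2l.
Qed.

(** The constant 3 is not optimal: the supremum of the ratio of heights is the
    square of the golden ratio, for alpha as well as for beta. *)
Lemma height_alpha_le (R : realType) (z : R[i]) : 0 < complex.Im z ->
  height (alpha z) <= 3 * height z.
Proof.
move=> z0.
rewrite height_alpha le_divl_scaled ?mulr_gt0 ?add1_normsq_gt0//.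
rewrite normsq_alpha /normsq; case: z {z0} => x y /=.
(* The difference of the two sides is ((2 x + 3)^2 + 1) / 2 + 2 y^2. *)
by have := sqr_ge0 (2 * x + 3); have := sqr_ge0 y; nra.
Qed.

Lemma height_beta_le (R : realType) (z : R[i]) : 0 < complex.Im z ->
  height (beta z) <= 3 * height z.
Proof.
move=> z0; rewrite height_beta//.
rewrite le_divl_scaled ?mulr_gt0 ?add1_normsq_gt0 ?normsq_pair_gt0//.
rewrite normsq_alpha /normsq; case: z {z0} => x y /=.
(* The difference of the two sides is ((5 x + 3)^2 + 1) / 5 + 5 y^2. *)
by have := sqr_ge0 (5 * x + 3); have := sqr_ge0 y; nra.
Qed.

Lemma height_alpha_gt (R : realType) (k : R) (z : R[i]) : 0 < complex.Im z ->
  (k * height z < height (alpha z)) = (k * (1 + normsq (alpha z)) < 1 + normsq z).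
Proof.
move=> z0; rewrite ltNge height_alpha.
by rewrite le_divl_scaled ?mulr_gt0 ?add1_normsq_gt0// -ltNge.
Qed.

Lemma height_beta_gt (R : realType) (k : R) (z : R[i]) : 0 < complex.Im z ->
  (k * height z < height (beta z)) =
  (k * (normsq z + normsq (alpha z)) < 1 + normsq z).
Proof.
move=> z0; rewrite ltNge height_beta//.
by rewrite le_divl_scaled ?mulr_gt0 ?add1_normsq_gt0 ?normsq_pair_gt0// -ltNge.
Qed.

(** * Growth of the inverse hyperbolic tangent *)

Definition artanh (R : realType) (t : R) : R := 2^-1 * (ln (1 + t) - ln (1 - t)).

Lemma artanh0 (R : realType) : artanh 0 = 0 :> R.
Proof. by rewrite /artanh addr0 subr0 subrr mulr0. Qed.

Lemma is_derive_artanh (R : realType) (t : R) : -1 < t < 1 ->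
  is_derive t 1 (@artanh R) (1 - t ^+ 2)^-1.
Proof.
move=> t1.
have d1 : is_derive (cst 1 t + t) 1 (@ln R) (1 + t)^-1.
  by apply: is_derive1_ln; rewrite /cst; lra.
have d2 : is_derive (cst 1 t - t) 1 (@ln R) (1 - t)^-1.
  by apply: is_derive1_ln; rewrite /cst; lra.
have -> : @artanh R = 2^-1 \*: ((@ln R \o (cst 1 + id)) - (@ln R \o (cst 1 - id))).
  by [].
apply: is_derive_eq.
by rewrite /GRing.scale/=; field; rewrite ?lt0r_neq0//; nra.
Qed.

(** The function t |-> artanh (k t) - k artanh t vanishes at 0 and has the
    derivative k / (1 - (k t)^2) - k / (1 - t^2) >= 0. *)
Lemma artanh_superlinear (R : realType) (k u : R) :
  1 <= k -> 0 < u -> k * u < 1 -> k * artanh u <= artanh (k * u).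
Proof.
move=> k1 u0 ku1.
pose h := @artanh R \o (k \*: id) - k \*: @artanh R.
pose dh t := k * (1 - (k * t) ^+ 2)^-1 - k * (1 - t ^+ 2)^-1.
have hd t : 0 <= t <= u -> is_derive t 1 h (dh t).
  move=> t0u.
  have d1 : is_derive ((k \*: id) t) 1 (@artanh R) (1 - (k * t) ^+ 2)^-1.
    by apply: is_derive_artanh; rewrite /= /GRing.scale/=; nra.
  have d2 : is_derive t 1 (@artanh R) (1 - t ^+ 2)^-1.
    by apply: is_derive_artanh; nra.
  by apply: is_derive_eq; rewrite /dh /GRing.scale/=; ring.
have [||c] := @MVT R h dh 0 u u0.
- by move=> t; rewrite in_itv/= => /andP[? ?]; apply: hd; lra.
- apply: derivable_within_continuous => t; rewrite in_itv/= => t0u.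
  by have [] := hd t t0u.
rewrite in_itv/= => /andP[c0 cu].
have hE t : h t = artanh (k * t) - k * artanh t by [].
rewrite !hE mulr0 artanh0 mulr0 !subr0 => {}hE.
have ck1 : (k * c) ^+ 2 < 1.
  by rewrite expr_lt1//; nra.
have ck : c ^+ 2 <= (k * c) ^+ 2.
  by rewrite lerXn2r ?nnegrE//; nra.
rewrite -subr_ge0 hE mulr_ge0 ?(ltW u0)// /dh -mulrBr.
apply: mulr_ge0; first lra.
by rewrite subr_ge0 lef_pV2 ?posrE; lra.
Qed.

Lemma ltr_artanh (R : realType) (u v : R) : -1 < u -> u < v -> v < 1 ->
  artanh u < artanh v.
Proof.
move=> u1 uv v1; rewrite ltr_pM2l ?invr_gt0// ltrB// ltr_ln ?posrE//; lra.
Qed.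

(** For v = 3 u, the worst case, exponentiation leads to the polynomial inequality
    (1 + 3 u) (1 - u)^4 < (1 - 3 u) (1 + u)^4; the difference of the two sides is
    2 u (1 - 14 u^2 - 3 u^4). *)
Lemma artanh_triple_lt (R : realType) (u v : R) :
  0 < u -> u < 5^-1 -> -1 < v -> v <= 3 * u ->
  artanh v < 4 * artanh u.
Proof.
move=> u0 u5 v0 vu.
rewrite /artanh mulrCA ltr_pM2l ?invr_gt0//.
apply: (@le_lt_trans _ _ (ln (1 + 3 * u) - ln (1 - 3 * u))).
  by rewrite lerB// ler_ln// ?posrE; lra.
rewrite mulrBr ltrBlDr addrAC ltrBrDr !mulr_natl -!lnXn; try lra.
rewrite -!lnM ?posrE ?exprn_gt0//; try lra.
rewrite ltr_ln ?posrE ?mulr_gt0 ?exprn_gt0//; try lra.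
rewrite -subr_gt0.
rewrite (_ : _ - _ = 2 * u * (1 - 14 * u ^+ 2 - 3 * u ^+ 4)); last by ring.
have u2 : u ^+ 2 < 25^-1 by nra.
have u4 : u ^+ 4 < 25^-1.
  by rewrite (_ : u ^+ 4 = u ^+ 2 * u ^+ 2); [nra|ring].
by rewrite mulr_gt0//; lra.
Qed.

(** * The potential as a function of the height *)

Lemma ln_sqrt (R : realType) (a : R) : 0 < a -> ln (Num.sqrt a) = 2^-1 * ln a.
Proof.
move=> a0; rewrite -[in RHS](sqr_sqrtr (ltW a0)) lnXn ?sqrtr_gt0//.
by field.
Qed.

(** The reduction of the potential to one real variable. *)
Lemma chiE (R : realType) (z : R[i]) : 0 < complex.Im z -> z != 'i%C ->
  chi z = (2^-1 * artanh (height z))%:E.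
Proof.
move=> z0 zi; rewrite /chi (negbTE zi).
have h1 := height_lt1 zi; have h0 := height_gt0 z0; have n0 := normsq_ge0 z.
rewrite normf_div !normc_def -fmorph_div/=.
have -> : complex.Re (z + 'i%C) ^+ 2 + complex.Im (z + 'i%C) ^+ 2 =
    (1 + normsq z) * (1 + height z).
  rewrite /height; case: z {z0 zi h0 h1} n0 => x y; rewrite /normsq/= => n0.
  by field; rewrite lt0r_neq0//; lra.
have -> : complex.Re (z - 'i%C) ^+ 2 + complex.Im (z - 'i%C) ^+ 2 =
    (1 + normsq z) * (1 - height z).
  rewrite /height; case: z {z0 zi h0 h1} n0 => x y; rewrite /normsq/= => n0.
  by field; rewrite lt0r_neq0//; lra.
have p0 : 0 < (1 + normsq z) * (1 + height z) by rewrite mulr_gt0//; lra.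
have m0 : 0 < (1 + normsq z) * (1 - height z) by rewrite mulr_gt0//; lra.
have p1 : 0 < 1 + height z by lra.
have m1 : 0 < 1 - height z by lra.
have n1 : 0 < 1 + normsq z by lra.
rewrite ln_div ?posrE ?sqrtr_gt0// !ln_sqrt// !lnM//.
rewrite /artanh; congr (_%:E); lra.
Qed.

(** The bound 1 / 5 makes both z and w stay away from i, where chi is
    infinite. *)
Lemma chi_lt (R : realType) (z w : R[i]) :
  0 < complex.Im z -> 0 < complex.Im w ->
  height z < 5^-1 -> height w <= 3 * height z -> (chi w < 4%:E * chi z)%E.
Proof.
move=> z0 w0 z5 wz; have hw := height_gt0 w0.
have zi : z != 'i%C by apply: contraTneq z5 => ->; rewrite height_i; lra.
have wi : w != 'i%C by apply: contraTneq wz => ->; rewrite height_i; lra.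
rewrite !chiE// -EFinM lte_fin (mulrCA 4) ltr_pM2l ?invr_gt0//.
by apply: artanh_triple_lt => //; [exact: height_gt0|lra].
Qed.

(** Here w = i is allowed, and harmless since chi i is infinite, whereas z = i
    is excluded because its image would have height larger than 1. *)
Lemma chi_gt (R : realType) (k : R) (z w : R[i]) :
  0 < complex.Im z -> 0 < complex.Im w ->
  1 <= k -> k * height z < height w -> (k%:E * chi z < chi w)%E.
Proof.
move=> z0 w0 k1 kzw; have hz := height_gt0 z0.
have hw1 : height w <= 1.
  by have [->|/height_lt1/ltW//] := eqVneq w 'i%C; rewrite height_i.
have zi : z != 'i%C by apply: contraTneq kzw => ->; rewrite height_i; lra.
rewrite chiE//; have [->|wi] := eqVneq w 'i%C.
  by rewrite /chi eqxx -EFinM ltry.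
rewrite chiE// -EFinM lte_fin (mulrCA k) ltr_pM2l ?invr_gt0//.
have w1 := height_lt1 wi.
apply: (le_lt_trans (artanh_superlinear k1 hz _)); first lra.
by apply: ltr_artanh => //; nra.
Qed.

(** * Neighbourhoods of boundary arcs *)

Lemma continuous_Re (R : realType) : continuous (@complex.Re R : R[i]^o -> R).
Proof.
move=> z A /nbhs_ballP[e /= e0 eA].
exists e%:C%C; first by rewrite /= ltcR.
move=> w zw; apply: eA; rewrite /ball/= -ltcR; apply: le_lt_trans zw.
by rewrite (le_trans _ (normc_ge_Re _))//; case: z w => [? ?] [? ?].
Qed.

(** Im z = Re (- i z). *)
Lemma continuous_Im (R : realType) : continuous (@complex.Im R : R[i]^o -> R).
Proof.
have -> : (@complex.Im R : R[i]^o -> R) =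
    (@complex.Re R : R[i]^o -> R) \o (fun z => - 'i%C * z).
  by apply/funext => -[x y] /=; rewrite oppr0 mul0r mulN1r sub0r opprK.
move=> z; apply: continuous_comp; last exact: continuous_Re.
exact: (@mulrl_continuous R[i]).
Qed.

Lemma continuous_normsq (R : realType) : continuous (@normsq R : R[i]^o -> R).
Proof.
move=> z; apply: (@cvgD _ _ _ (nbhs z) (nbhs_filter z)).
  apply: (cvg_comp _ (fun x => x ^+ 2) (@continuous_Re R z)).
  exact: exprn_continuous.
apply: (cvg_comp _ (fun x => x ^+ 2) (@continuous_Im R z)).
exact: exprn_continuous.
Qed.

Lemma continuous_real_complex (R : realType) :
  continuous (fun x : R => x%:C%C : R[i]^o).
Proof.
move=> x; apply/cvgrPdist_lt => e e0.
have er : e = (complex.Re e)%:C%C by rewrite RRe_real// ger0_real// ltW.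
move: e0; rewrite er ltcR => e0.
near=> y; rewrite -rmorphB normc_def/= expr0n/= addr0 sqrtr_sqr ltcR.
by near: y; exact: cvgr_dist_lt.
Unshelve. all: by end_near. Qed.

(** The comparisons of heights used below take this form once the denominators
    are cleared. *)
Lemma open_circle_side (R : realType) (a b c d : R) :
  open ([set z | 0 < a * normsq z + b * complex.Re z + c * complex.Im z + d]
        : set R[i]^o).
Proof.
pose f (z : R[i]^o) := a * normsq z + b * complex.Re z + c * complex.Im z + d.
apply: (@open_comp _ _ f [set x | 0 < x]); last exact: open_gt.
move=> z _.
have F := nbhs_filter z.
apply: (@cvgD _ _ _ (nbhs z)); last exact: cvg_cst.
apply: (@cvgD _ _ _ (nbhs z)).
  apply: (@cvgD _ _ _ (nbhs z)); apply: (@cvgM _ _ (nbhs z));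
  [exact: cvg_cst|exact: continuous_normsq|exact: cvg_cst|exact: continuous_Re].
by apply: (@cvgM _ _ (nbhs z)); [exact: cvg_cst|exact: continuous_Im].
Qed.

(** Such a set is contained in a square of the plane, the continuous image of
    a product of two segments. *)
Lemma compact_normsq_le (R : realType) (r : R) (C : set R[i]^o) :
  closed C -> (forall z, C z -> normsq z <= r) -> compact C.
Proof.
move=> clC Cr; pose s := 1 + r.
pose f (p : R * R) : R[i]^o := p.1%:C%C + 'i%C * p.2%:C%C.
apply: (@subclosed_compact _ _ (f @` (`[-s, s] `*` `[-s, s]))) => //.
  apply: continuous_compact; last by apply: compact_setX; exact: segment_compact.
  apply: continuous_subspaceT => p; apply: cvgD.
    by apply: continuous_comp; [exact: cvg_fst|exact: continuous_real_complex].
  apply: cvgM; first exact: cvg_cst.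
  by apply: continuous_comp; [exact: cvg_snd|exact: continuous_real_complex].
move=> z /Cr zr; exists (complex.Re z, complex.Im z); last first.
  by rewrite /f [RHS]complexE.
by rewrite /normsq in zr; split; rewrite /= in_itv/= /s; nra.
Qed.

Lemma half_plane_nbhd_real_arc (R : realType) (a b : R) (V : set R[i]) :
  open (V : set R[i]^o) -> (forall x, a <= x <= b -> V x%:C%C) ->
  half_plane_nbhd (real_arc a b) (upper_half_plane R `&` V).
Proof.
move=> oV abV; exists (Some @` V); split.
- exact: one_point_compactification_open_some.
- by move=> _ [x /= xab <-]; exists x%:C%C => //; apply: abV; rewrite in_itv in xab.
- congr (_ `&` _); apply/seteqP; split => z; first by exists z.
  by move=> [w Vw [<-]].
Qed.

(** The neighbourhoods of infinity in the sphere are the complements of compact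
    sets, whence the boundedness of the complement of V. *)
Lemma half_plane_nbhd_nonpositive_arc (R : realType) (r : R) (V : set R[i]) :
  open (V : set R[i]^o) -> (forall z, ~ V z -> normsq z <= r) ->
  (forall x, x <= 0 -> V x%:C%C) ->
  half_plane_nbhd (nonpositive_arc R) (upper_half_plane R `&` V).
Proof.
move=> oV Vr xV; exists ([set None] `|` Some @` V); split.
- rewrite openE => -[z|] Uz.
    apply: (@filterS _ _ _ (Some @` V)); first by right.
    apply: one_point_compactification_some_nbhs; apply: open_nbhs_nbhs.
    by split => //; case: Uz => [//|[w Vw [<-]]].
  have cV : closed (~` V : set R[i]^o) by exact: open_closedC.
  exists (~` V); last by rewrite setCK setUC.
  by split => //; exact: compact_normsq_le Vr.
- move=> _ [->|[x /= x0 <-]]; first by left.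
  by right; exists x%:C%C => //; apply: xV; rewrite in_itv in x0.
- congr (_ `&` _); apply/seteqP; split => z; first by right; exists z.
  by move=> [//|[w Vw [<-]]].
Qed.

(** * Expansion near the boundary *)

Theorem lemma2 (R : realType) :
  exists lambda_plus : R,
    [/\ 1 < lambda_plus,
        exists N : set R[i],
          half_plane_nbhd (nonpositive_arc R) N /\
          forall z, N z ->
            (chi (alpha z) < lambda_plus%:E * chi z)%E /\
            (chi (beta z) < lambda_plus%:E * chi z)%E
      & forall K : R, 1 < K ->
        exists lambda_minus : R,
          (1 < lambda_minus /\ lambda_minus < lambda_plus) /\
          exists N1 N2 : set R[i],
            [/\ half_plane_nbhd (real_arc (- K) (- 1)) N1,
                half_plane_nbhd (real_arc (- 1) (- K^-1)) N2,
                forall z, N1 z -> (lambda_minus%:E * chi z < chi (alpha z))%E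
              & forall z, N2 z -> (lambda_minus%:E * chi z < chi (beta z))%E]].
Proof.
exists 4; split; first lra.
  (* The set where the height is less than 1 / 5. *)
  exists (upper_half_plane R `&`
    [set z | 0 < 1 * normsq z + 0 * complex.Re z + (- 10) * complex.Im z + 1]).
  split.
    (* |z|^2 < 10 Im z off that set, so that Im z < 10 and |z|^2 < 100. *)
    apply: (@half_plane_nbhd_nonpositive_arc R 100) => [|z|x x0].
    - exact: open_circle_side.
    - by move/negP; rewrite -leNgt /normsq; nra.
    - by rewrite /normsq/=; nra.
  move=> z [/= z0 zV].
  have z5 : height z < 5^-1.
    by rewrite ltr_pdivrMr; have := normsq_ge0 z; lra.
  have [az bz] := (Im_alpha z, Im_beta z).
  split; apply: chi_lt => //; first by rewrite az.
  - exact: height_alpha_le.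
  - by rewrite bz divr_gt0// normsq_gt0// Im_alpha.
  - exact: height_beta_le.
move=> K K1.
pose d := (1 + K ^+ 2)^-1; pose k := 1 + d.
have d0 : 0 < d by rewrite invr_gt0; nra.
have dK : d * (1 + K ^+ 2) = 1 by rewrite mulVf// lt0r_neq0//; nra.
have d1 : d < 1 by nra.
exists k; split; first by rewrite /k; split; lra.
(* The two sets where the height grows by a factor larger than k, the condition
   being expanded in terms of |z|^2 and Re z. *)
exists (upper_half_plane R `&` [set z |
  0 < (1 - k) * normsq z + (- 2 * k) * complex.Re z + 0 * complex.Im z
      + (1 - 2 * k)]).
exists (upper_half_plane R `&` [set z |
  0 < (1 - 2 * k) * normsq z + (- 2 * k) * complex.Re z + 0 * complex.Im z
      + (1 - k)]).
split.
- apply: half_plane_nbhd_real_arc => [|x /andP[xK x1]].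
    exact: open_circle_side.
  have xK2 : (x + 1) ^+ 2 <= (K - 1) ^+ 2.
    have : 0 <= (K - x - 2) * (K + x) by apply: mulr_ge0; lra.
    by nra.
  have dx : d * (1 + (x + 1) ^+ 2) < 1.
    by rewrite -dK ltr_pM2l//; nra.
  by rewrite /normsq /k/=; nra.
- apply: half_plane_nbhd_real_arc => [|x /andP[x1 xK]].
    exact: open_circle_side.
  have dKV : d < K^-1 by rewrite ltf_pV2 ?posrE; nra.
  have Vx : K^-1 <= - x * (2 + x).
    have : 0 <= (- x - K^-1) * (2 + x) by apply: mulr_ge0; lra.
    have : 0 <= K^-1 * (1 + x) by apply: mulr_ge0; lra.
    by nra.
  have dx : 0 <= d * (- x * (1 + x)).
    by rewrite mulr_ge0 ?(ltW d0)// mulr_ge0//; lra.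
  by rewrite /normsq /k/=; nra.
- move=> z [/= z0 zV]; apply: chi_gt => //; first by rewrite Im_alpha.
    by rewrite /k; lra.
  by rewrite height_alpha_gt// normsq_alpha; lra.
- move=> z [/= z0 zV]; apply: chi_gt => //.
  + by rewrite Im_beta divr_gt0// normsq_gt0// Im_alpha.
  + by rewrite /k; lra.
  by rewrite height_beta_gt// normsq_alpha; lra.
Qed.
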